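(* There exists a constant $c>0$ such that for every $k \in \mathbb{N}$ there exists a constant $c_k>0$ such that for all $n \in \mathbb{N}$ there exist integers $a_1, \dots, a_k$ with $1 \leq a_1, \dots, a_k \leq n$ and $$ 0 < \left\| \sqrt{a_1} + \dots + \sqrt{a_k} \right\| \leq c_k \cdot n^{-c \cdot k^{1/3}}.$$
   Context: $\mathbb{N}$ denotes the positive integers. For a real number $x$, $\|x\| = \min_{m \in \mathbb{Z}} |x-m|$ denotes the distance from $x$ to the nearest integer.
   Formalization: The claim is proved for all integers n ≥ 2 instead of n ≥ 1: for n = 1 every a_i equals 1, the sum of the square roots is the integer k, and its distance to the nearest integer is 0, so the strict inequality fails. *)

(* Defs.v *)
From HB Require Import structures.
From mathcomp Require Import all_boot all_order all_algebra.
From mathcomp Require Import all_classical all_reals all_analysis.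

Set Implicit Arguments.
Unset Strict Implicit.
Unset Printing Implicit Defensive.

Import Order.TTheory GRing.Theory Num.Theory.

Local Open Scope classical_set_scope.
Local Open Scope ring_scope.

(* The infimum is a minimum, as [dist_int_le] and [dist_int_attained] show. *)
Definition dist_int (R : realType) (x : R) : R :=
  inf [set `|x - m%:~R| | m in [set: int]].

Lemma dist_int_le (R : realType) (x : R) (m : int) :
  dist_int x <= `|x - m%:~R|.
Proof.
by apply: ge_inf; [exists 0 => _ [p _ <-] | exists m].
Qed.

Lemma dist_int_attained (R : realType) (x : R) :
  exists m : int, dist_int x = `|x - m%:~R|.
Proof.
have [m mP] : exists m : int, forall p : int, `|x - m%:~R| <= `|x - p%:~R|.
  have fl := floor_le x; have fu := floorD1_gt x.
  set f := Num.floor x in fl fu.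
  have E1 : `|x - f%:~R| = x - f%:~R by rewrite ger0_norm ?subr_ge0.
  have E2 : `|x - (f + 1)%:~R| = (f + 1)%:~R - x.
    by rewrite ler0_norm ?opprB // subr_le0 ltW.
  have key (p : int) :
      `|x - f%:~R| <= `|x - p%:~R| \/ `|x - (f + 1)%:~R| <= `|x - p%:~R|.
    have [pf|fp] := lerP p f.
      have pfR : p%:~R <= f%:~R :> R by rewrite ler_int.
      left; rewrite E1; apply: le_trans (ler_norm _).
      by rewrite lerD2l lerN2.
    have fpR : (f + 1)%:~R <= p%:~R :> R by rewrite ler_int lezD1.
    right; rewrite E2 distrC; apply: le_trans (ler_norm _).
    by rewrite lerD2r.
  have [h|/ltW h] := lerP `|x - f%:~R| `|x - (f + 1)%:~R|.
    by exists f => p; case: (key p) => // /(le_trans h).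
  by exists (f + 1) => p; case: (key p) => // /(le_trans h).
exists m; apply/le_anti; rewrite dist_int_le /=.
by apply: lb_le_inf; [exists `|x - m%:~R|, m | move=> _ [p _ <-]].
Qed.

(* Main.v *)
Require Import Defs.
From HB Require Import structures.
From mathcomp Require Import all_boot all_order all_algebra.
From mathcomp Require Import all_classical all_reals all_analysis.
From mathcomp Require Import ring lra zify.

(* With x = 1/M and t = 1/q, the square root of the integer
     w^2 (q^2 (M + b)^2 + 4 s q),   s = 1 or -1,
   is w q M sqrt((1 + b x)^2 + 4 t s x^2) = w q (M + b) + 2 w (h_0 x + h_1 x^2 + ...),
   where h_j is a polynomial in t with constant term s (-b)^j. Take k such numbers
   with b_i = k - 1 - i and s_i = (-1)^i. The sum of the roots is an integer plus
   2 d x^k + O(x^(k+1)) with d <> 0 as soon as the weights w_i satisfy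
     sum_i w_i h_{i,j} = 0 (j < k - 1),   sum_i w_i h_{i,k-1} = d.
   By Cramer's rule, the cofactors along the last row of the matrix (h_{i,j}) solve
   this system, with d its determinant. At t = 0 the matrix is a Vandermonde matrix
   with columns of alternating signs, hence these cofactors are nonzero and share one
   sign; this persists for t = 1/q with q large, and clearing denominators gives
   positive integer weights. As the k numbers are O(M^2), the distance to the nearest
   integer is O(n^(-k/2)), and k >= k^(1/3). *)

Set Implicit Arguments.
Unset Strict Implicit.
Unset Printing Implicit Defensive.

Import Order.TTheory GRing.Theory Num.Theory.

Local Open Scope ring_scope.

(** * Truncated power series for the square root *)

(* [1 + b X + 2 t X^2 H] is the square root of [(1 + b X)^2 + 4 t s X^2] up to
   order [N + 2]: this is what the equation for [H] says after expanding. *)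
Lemma truncated_root (R : comNzRingType) (b t s : R) (N : nat) :
  exists H E : {poly R},
    (1 + b%:P * 'X) * H + t%:P * 'X^2 * H ^+ 2 = s%:P + 'X^N * E.
Proof.
elim: N => [|N [H [E HE]]].
  by exists 0, (- s%:P); ring.
have [E' [e0 defE]] : exists E' e, E = E' * 'X + e%:P.
  by elim/poly_ind: E {HE} => [|E' e _]; [exists 0, 0; ring | exists E', e].
(* The lowest error coefficient [e0] is cancelled: [1 + b X] has constant term 1, and the quadratic
   term changes only from order [N + 2] on. *)
exists (H - e0%:P * 'X^N).
exists (E' - b%:P * e0%:P
        + t%:P * 'X * (e0%:P ^+ 2 * 'X^N - 2 * H * e0%:P)).
move: HE; rewrite {}defE (exprS _ N); set Y := 'X^N => HE.
transitivity ((1 + b%:P * 'X) * H + t%:P * 'X^2 * H ^+ 2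
   - Y * (1 + b%:P * 'X) * e0%:P
   + t%:P * 'X^2 * (e0%:P ^+ 2 * Y ^+ 2 - 2 * H * e0%:P * Y)); first by ring.
by rewrite HE; ring.
Qed.

(** The parameter [t] is first kept formal; this transports the equation both to [t = 0] and to
    [t = 1/q]. *)
Lemma map_truncated_root (aR rR : comNzRingType) (f : {rmorphism aR -> rR})
    (b t s : aR) (N : nat) (H E : {poly aR}) :
  (1 + b%:P * 'X) * H + t%:P * 'X^2 * H ^+ 2 = s%:P + 'X^N * E ->
  (1 + (f b)%:P * 'X) * map_poly f H + (f t)%:P * 'X^2 * map_poly f H ^+ 2 =
  (f s)%:P + 'X^N * map_poly f E.
Proof.
move=> /(congr1 (map_poly f)).
by rewrite !(rmorphXn, rmorphD, rmorphM, rmorph1) /= !map_polyC !map_polyX.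
Qed.

(** This is the case [t = 0]: modulo [X^N], [H] is the geometric series of [s / (1 + b X)]. *)
Lemma coef_geometric (R : comNzRingType) (b s : R) (N : nat) (H E : {poly R}) :
  (1 + b%:P * 'X) * H = s%:P + 'X^N * E ->
  forall j, (j < N)%N -> H`_j = s * (- b) ^+ j.
Proof.
move=> HE; elim=> [|j IHj] ltjN; move/polyP: HE => HE.
  move: (HE 0); rewrite mulrDl mul1r -mulrA !coefD coefCM coefXM coefC coefXnM.
  by rewrite ltjN /= mulr0 !addr0 mulr1.
move: (HE j.+1); rewrite mulrDl mul1r -mulrA !coefD coefCM coefXM coefC coefXnM.
rewrite ltjN /= IHj ?(ltnW ltjN) // addr0 => /eqP; rewrite addr_eq0 => /eqP->.
by rewrite exprS; ring.
Qed.

(** * Vandermonde matrices with signed columns *)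

Lemma det_vandermonde_gt0 (R : realDomainType) (y : nat -> R) (n : nat)
    (f : 'I_n -> nat) :
  {homo y : i j / (i < j)%N >-> i < j} ->
  {homo f : i j / (i < j)%N >-> (i < j)%N} ->
  0 < \det (\matrix_(j < n, i < n) y (f i) ^+ j).
Proof.
move=> y_incr f_incr; set V := \matrix_(_, _) _.
have -> : V = Vandermonde n (\row_i y (f i)) by apply/matrixP=> j i; rewrite !mxE.
rewrite det_Vandermonde; apply: prodr_gt0 => i _; apply: prodr_gt0 => j ltij.
by rewrite !mxE subr_gt0 y_incr ?f_incr.
Qed.

Lemma det_signed_vandermondeE (R : comNzRingType) (y : nat -> R) (n : nat)
    (f : 'I_n -> nat) :
  \det (\matrix_(j < n, i < n) ((-1) ^+ f i * y (f i) ^+ j)) =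
  \det (\matrix_(j < n, i < n) y (f i) ^+ j) * \prod_i (-1) ^+ f i.
Proof.
transitivity (\det ((\matrix_(j < n, i < n) y (f i) ^+ j)
                    *m diag_mx (\row_i (-1) ^+ f i))).
  by congr (\det _); apply/matrixP=> j i; rewrite mul_mx_diag !mxE mulrC.
rewrite det_mulmx det_diag; congr (_ * _).
by apply: eq_bigr => i _; rewrite mxE.
Qed.

Lemma prod_sign_neq0 (R : idomainType) (n : nat) (f : 'I_n -> nat) :
  \prod_i (-1) ^+ f i != 0 :> R.
Proof. by apply/prodf_neq0 => i _; rewrite signr_eq0. Qed.

Lemma det_signed_vandermonde_neq0 (R : realDomainType) (K : nat)
    (y : nat -> R) :
  {homo y : i j / (i < j)%N >-> i < j} ->
  \det (\matrix_(j < K, i < K) ((-1) ^+ i * y i ^+ j)) != 0.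
Proof.
move=> y_incr; rewrite (det_signed_vandermondeE _ (fun i : 'I_K => i)).
by rewrite mulf_neq0 ?prod_sign_neq0 // gt_eqF // det_vandermonde_gt0.
Qed.

(* The signs [(-1) ^+ i] of the columns compensate the alternating signs of the
   cofactors along the last row. *)
Lemma cofactor_signed_vandermonde_gt0 (R : realDomainType) (K : nat)
    (y : nat -> R) (i : 'I_K.+1) :
  {homo y : i j / (i < j)%N >-> i < j} ->
  0 < (-1) ^+ K * \prod_(l < K.+1) (-1) ^+ l *
      cofactor (\matrix_(j < K.+1, i < K.+1) ((-1) ^+ i * y i ^+ j)) ord_max i.
Proof.
move=> y_incr; set A := \matrix_(_, _) _; set eps := _ * \prod_(_ < _) _.
have -> : cofactor A ord_max i =
    (-1) ^+ (K + i) * (\det (\matrix_(j < K, l < K) y (lift i l) ^+ j)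
                       * \prod_l (-1) ^+ lift i l).
  rewrite -(det_signed_vandermondeE _ (fun l => lift i l)) /cofactor.
  congr (_ * \det _).
  by apply/matrixP=> j l; rewrite !mxE lift_max.
(* Splitting the sign of column [i] off [eps] leaves exactly the sign of the cofactor, so their
   product is [eps ^+ 2] times a Vandermonde determinant. *)
have epsE : eps = (-1) ^+ (K + i) * \prod_(l < K) (-1) ^+ lift i l.
  by rewrite /eps (bigD1_ord i) //= exprD mulrA.
set P := \prod_(l < K) _ in epsE *; set D := \det _.
have -> : eps * ((-1) ^+ (K + i) * (D * P)) = eps ^+ 2 * D by rewrite epsE; ring.
rewrite mulr_gt0 //.
  by rewrite exprn_even_gt0 //= mulf_neq0 ?signr_eq0 ?prod_sign_neq0.
apply: det_vandermonde_gt0 => // a b ltab /=.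
by rewrite /bump; lia.
Qed.

(** * Values of polynomials at [1/q] *)

Lemma horner_bounded (R : realDomainType) (p : {poly R}) :
  exists2 C : R, 0 <= C & forall x, 0 <= x <= 1 -> `|p.[x]| <= C.
Proof.
exists (\sum_(i < size p) `|p`_i|); first by apply: sumr_ge0.
move=> x /andP[x0 x1]; rewrite horner_coef.
apply: le_trans (ler_norm_sum _ _ _) _; apply: ler_sum => i _.
by rewrite normrM ler_piMr // normrX (ger0_norm x0) exprn_ile1.
Qed.

(** The constant term [e] dominates: the other terms amount to at most [C / q] in absolute value,
    and [q > C / e]. *)
Lemma horner_inv_gt0 (R : realType) (p : {poly R}) : 0 < p.[0] ->
  exists q0 : nat, forall q, (q0 < q)%N -> 0 < p.[q%:R^-1].
Proof.
elim/poly_ind: p => [|p e _]; first by rewrite horner0 ltxx.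
rewrite hornerMXaddC mulr0 add0r => e0.
have [C C0 CP] := horner_bounded p.
exists (Num.trunc (C / e)) => q ltq; rewrite hornerMXaddC.
have q0 : 0 < q%:R :> R by rewrite ltr0n; case: q ltq.
have qC : C / e < q%:R.
  have /andP[_ /lt_le_trans->//] := truncn_itv (divr_ge0 C0 (ltW e0)).
  by rewrite ler_nat.
have : - C <= p.[q%:R^-1].
  by rewrite lerNl (le_trans (ler_norm _)) // normrN CP // invr_ge0 ltW //=
    invf_le1 // ler1n; case: q ltq {q0 qC}.
rewrite -(ler_pM2r (_ : 0 < q%:R^-1)) ?invr_gt0 // => h.
have : C / q%:R < e by rewrite ltr_pdivrMr // mulrC -ltr_pdivrMr.
by lra.
Qed.

(** Any [m] at least the degree clears the denominators, so a common [m] can serve all the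
    weights. *)
Lemma horner_inv_int (R : realFieldType) (p : {poly int}) (q m : nat) :
  (0 < q)%N -> (size p <= m.+1)%N ->
  exists z : int, q%:R ^+ m * (map_poly intr p).[q%:R^-1] = z%:~R :> R.
Proof.
move=> q0 sp; exists (\sum_(i < m.+1) p`_i * q%:Z ^+ (m - i)).
rewrite (@horner_coef_wide _ m.+1); last exact: leq_trans (size_poly _ _) sp.
rewrite mulr_sumr rmorph_sum; apply: eq_bigr => i _ /=.
have qn0 : q%:R != 0 :> R by rewrite pnatr_eq0 -lt0n.
rewrite coef_map /= rmorphM rmorphXn /= -pmulrn.
have -> : q%:R ^+ m = q%:R ^+ (m - i) * q%:R ^+ i :> R.
  by rewrite -exprD subnK // -ltnS.
by rewrite exprVn; field; rewrite expf_neq0.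
Qed.

(** * Positive integer weights cancelling the low-order coefficients *)

Lemma positive_weights (R : realType) (K : nat) :
  exists q : nat, exists w : 'I_K.+1 -> nat, exists H : 'I_K.+1 -> {poly R},
  exists d : R,
  [/\ (0 < q)%N, forall i, (0 < w i)%N,
    forall i : 'I_K.+1, exists E, (1 + (K - i)%:R%:P * 'X) * H i
       + (q%:R^-1)%:P * 'X^2 * H i ^+ 2 = ((-1) ^+ i)%:P + 'X^(K.+1) * E,
    d != 0 &
    forall j : 'I_K.+1, \sum_i (w i)%:R * (H i)`_j = d *+ (j == ord_max)].
Proof.
(* Here [t] is the variable of [{poly int}], so the cofactors are integer polynomials in [t]. *)
have [H HP] := fin_all_exists (fun i : 'I_K.+1 =>
  truncated_root ((K - i)%:R : {poly int}) 'X ((-1) ^+ i) K.+1).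
pose y (i : nat) : int := i%:Z - K%:Z.
have y_incr : {homo y : i j / (i < j)%N >-> i < j}.
  by move=> i j; rewrite /y; lia.
pose B : 'M[{poly int}]_K.+1 := \matrix_(j, i) (H i)`_j.
pose eps : int := (-1) ^+ K * \prod_(l < K.+1) (-1) ^+ l.
have B0 : map_mx (horner_eval 0) B = \matrix_(j, i) ((-1) ^+ i * y i ^+ j).
  apply/matrixP=> j i; rewrite !mxE.
  have [E /(map_truncated_root (horner_eval 0))] := HP i.
  rewrite /= [horner_eval _ 'X]hornerX !mul0r addr0. rewrite rmorph_nat rmorphXn rmorphN1.
  move=> /coef_geometric/(_ j (ltn_ord j)); rewrite coef_map /= => ->.
  by rewrite /y; congr (_ * _ ^+ _); have := ltn_ord i; lia.
(* [eps] carries the common sign of the cofactors at [t = 0], which makes every [u i] positive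
   there. *)
pose u i := eps%:P * cofactor B ord_max i.
have u0 i : 0 < (u i).[0].
  rewrite hornerM hornerC -[X in _ * X]/(horner_eval 0 _) -cofactor_map_mx B0.
  exact: cofactor_signed_vandermonde_gt0.
have D0 : (\det B).[0] != 0.
  by rewrite -[X in X != 0]/(horner_eval 0 _) -det_map_mx B0
    det_signed_vandermonde_neq0.
have Bu j : \sum_i B j i * u i = (eps%:P * \det B) *+ (j == ord_max).
  have /matrixP/(_ j ord_max) := mul_mx_adj B; rewrite !mxE => HB.
  rewrite -mulrnAr -HB mulr_sumr; apply: eq_bigr => i _.
  by rewrite /u ?mxE; ring.
pose M : {poly int} -> {poly R} := map_poly intr.
have M0 p : (M p).[0] = (p.[0])%:~R by rewrite -[0 in LHS](rmorph0 intr) horner_map.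
have [qu quP] : exists qu : 'I_K.+1 -> nat, forall i q,
    (qu i < q)%N -> 0 < (M (u i)).[q%:R^-1].
  apply: (fin_all_exists (P := fun i q0 => forall q,
    (q0 < q)%N -> 0 < (M (u i)).[q%:R^-1])) => i.
  by apply: horner_inv_gt0; rewrite M0 ltr0z.
(* Squaring turns the nonvanishing of [\det B] at [t = 0] into a positivity, to which
   [horner_inv_gt0] applies. *)
have [qD qDP] : exists qD, forall q,
    (qD < q)%N -> 0 < (M (\det B ^+ 2)).[q%:R^-1].
  apply: horner_inv_gt0; rewrite M0 ltr0z horner_exp exprn_even_gt0 //.
pose q := (qD + \sum_i qu i).+1.
have ltqu i : (qu i < q)%N by rewrite ltnS (bigD1 i) //= addnCA leq_addr.
pose phi : {rmorphism {poly int} -> R} := horner_eval (q%:R^-1 : R) \o M.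
pose m := (\sum_i size (u i))%N.
have size_le i : (size (u i) <= m)%N by rewrite /m (bigD1 i) //= leq_addr.
have [z zP] := fin_all_exists (fun i => @horner_inv_int R (u i) q m (ltn0Sn _)
  (leqW (size_le i))).
have q_gt0 : 0 < q%:R ^+ m :> R by rewrite exprn_gt0 // ltr0n.
have z_gt0 i : 0 < z i.
  by rewrite -(ltr0z R) -zP mulr_gt0 // quP.
have wP i : `|z i|%:R = (z i)%:~R :> R by rewrite pmulrn gtz0_abs.
exists q, (fun i => `|z i|%N), (fun i => map_poly phi (H i)).
exists (q%:R ^+ m * phi (eps%:P * \det B)); split=> //.
- by move=> i; rewrite absz_gt0 gt_eqF.
- move=> i; have [E /(map_truncated_root phi) HE] := HP i.
  exists (map_poly phi E); move: HE; rewrite rmorph_nat rmorphXn rmorphN1.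
  suff -> : phi 'X = q%:R^-1 by [].
  by rewrite /phi /= /M map_polyX [LHS]hornerX.
- have phi_eps : phi eps%:P = eps%:~R by rewrite /phi /= /M map_polyC [LHS]hornerC.
  have phi_det : phi (\det B) != 0.
    have : 0 < phi (\det B ^+ 2) by apply: qDP; rewrite ltnS leq_addr.
    by rewrite (rmorphXn phi) exprn_even_gt0.
  rewrite (rmorphM phi) phi_eps !mulf_neq0 ?(gt_eqF q_gt0) // intr_eq0.
  by rewrite /eps mulf_neq0 ?signr_eq0 ?prod_sign_neq0.
move=> j; rewrite -mulrnAr -rmorphMn -Bu rmorph_sum mulr_sumr.
apply: eq_bigr => i _; rewrite coef_map wP -zP [B j i]mxE (rmorphM phi).
by rewrite [RHS]mulrA [RHS]mulrAC.
Qed.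

(** * Error of the truncated expansion *)

Lemma sqrt_approx (R : rcfType) (b t s : R) (N : nat) (H E : {poly R}) :
  (1 + b%:P * 'X) * H + t%:P * 'X^2 * H ^+ 2 = s%:P + 'X^N * E ->
  exists2 C : R, 1 <= C & forall x, 0 < x -> C * x <= 1 ->
    `|Num.sqrt ((1 + b * x) ^+ 2 + 4 * t * s * x ^+ 2)
      - (1 + b * x + 2 * t * x ^+ 2 * H.[x])| <= C * x ^+ N.+2.
Proof.
move=> HE.
have [C1 C1_ge0 C1P] := horner_bounded (b%:P + (2 * t)%:P * 'X * H).
have [C2 C2_ge0 C2P] := horner_bounded ((16 * t)%:P * E).
(* When [C * x <= 1], the summand [1] gives [x <= 1], [2 * C1] gives [S >= 1 / 2], and [C2] then
   gives [P >= 0]. *)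
exists (1 + 2 * C1 + C2); first by lra.
move=> x x_gt0 Cx.
have x_le1 : x <= 1 by nra.
have x01 : 0 <= x <= 1 by rewrite ltW.
have {HE} : (1 + b * x) * H.[x] + t * x ^+ 2 * H.[x] ^+ 2 = s + x ^+ N * E.[x].
  have := congr1 (horner^~ x) HE.
  by rewrite !(horner_exp, hornerD, hornerM, hornerC, hornerX).
have {C1P} := C1P _ x01; have {C2P} := C2P _ x01.
rewrite !(hornerD, hornerM, hornerC, hornerX); set h := H.[x]; set e := E.[x].
set u := b + _; set v := _ * e => v_le u_le HE.
set S := 1 + b * x + _; set P := (1 + b * x) ^+ 2 + _.
have PE : P = S ^+ 2 - v / 4 * x ^+ N.+2.
  have -> : P = (1 + b * x) ^+ 2 + 4 * t * x ^+ 2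
                * ((1 + b * x) * h + t * x ^+ 2 * h ^+ 2 - x ^+ N * e).
    by rewrite HE /P; ring.
  rewrite /S /v !exprS; set X := x ^+ N; by field.
have xN : 0 <= x ^+ N.+2 <= x.
  apply/andP; split; first exact: exprn_ge0 (ltW x_gt0).
  rewrite exprS; apply: ler_piMr; first exact: ltW.
  by apply: exprn_ile1 => //; apply: ltW.
have v_norm : `|v / 4 * x ^+ N.+2| <= C2 / 4 * x ^+ N.+2.
  have [X_ge0 _] := andP xN.
  rewrite normrM [`|x ^+ _|]ger0_norm // ler_wpM2r // normrM.
  by rewrite [`|4^-1|]ger0_norm ?invr_ge0 // ler_wpM2r ?invr_ge0.
have S_ge : 1 / 2 <= S.
  have -> : S = 1 + x * u by rewrite /S /u; ring.
  have : `|x * u| <= x * C1 by rewrite normrM gtr0_norm // ler_pM2l.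
  by rewrite ler_norml => /andP[]; nra.
have P_ge0 : 0 <= P.
  move: v_norm; rewrite ler_norml => /andP[_ v_norm].
  by rewrite PE; case/andP: xN => ? ?; nra.
have sqP := sqr_sqrtr P_ge0; have r0 := sqrtr_ge0 P.
set r := Num.sqrt P in sqP r0 *.
(* Since [r + S >= 1 / 2], a bound on [r ^+ 2 - S ^+ 2 = P - S ^+ 2] suffices. *)
have : `|r - S| * (r + S) <= C2 / 4 * x ^+ N.+2.
  rewrite -[X in _ * X <= _]ger0_norm; last by lra.
  rewrite -normrM (_ : _ * _ = - (v / 4 * x ^+ N.+2)) ?normrN //.
  have -> : v / 4 * x ^+ N.+2 = S ^+ 2 - r ^+ 2 by rewrite sqP PE; ring.
  by ring.
have := normr_ge0 (r - S).
by case/andP: xN => ? ?; nra.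
Qed.

(** * Sums of square roots close to an integer *)

(* [w ^ 2 * (q ^ 2 * (M + b) ^ 2 + 4 * (-1) ^ i * q)]; the truncated subtraction
   is harmless when [M > 2]. *)
Definition radicand (q w b i M : nat) : nat :=
  (w ^ 2 * (if odd i then q ^ 2 * (M + b) ^ 2 - 4 * q
            else q ^ 2 * (M + b) ^ 2 + 4 * q))%N.

Lemma radicand_bounds (q w b i M : nat) :
  (0 < q)%N -> (0 < w)%N -> (2 < M)%N ->
  (1 <= radicand q w b i M <= (w * q * (b + 3) * M) ^ 2)%N.
Proof.
move=> q0 w0 M2; rewrite /radicand.
have qM : (4 * q < q ^ 2 * (M + b) ^ 2)%N.
  have : (4 < (M + b) ^ 2)%N by nia.
  have : (q <= q ^ 2)%N by nia.
  by nia.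
have up : (q ^ 2 * (M + b) ^ 2 + 4 * q <= (q * (b + 3) * M) ^ 2)%N.
  have h : (M + b + 2 <= (b + 3) * M)%N by nia.
  apply: (@leq_trans ((q * (M + b + 2)) ^ 2)); last first.
    by rewrite leq_exp2r // -mulnA leq_mul2l h orbT.
  by rewrite expnMn; nia.
apply/andP; split.
  by rewrite muln_gt0 expn_gt0 w0 /=; case: odd; lia.
have -> : (w * q * (b + 3) * M = w * (q * (b + 3) * M))%N by rewrite !mulnA.
rewrite (expnMn w) leq_mul2l; apply/orP; right.
by case: odd => //; apply: leq_trans up; lia.
Qed.

Lemma sqrt_radicand (R : realType) (q w b i M : nat) :
  (0 < q)%N -> (2 < M)%N ->
  Num.sqrt (radicand q w b i M)%:R =
  (w * q * M)%:R * Num.sqrt ((1 + b%:R * M%:R^-1) ^+ 2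
      + 4 * q%:R^-1 * (-1) ^+ i * M%:R^-1 ^+ 2) :> R.
Proof.
move=> q0 M2.
have qM : (4 * q <= q ^ 2 * (M + b) ^ 2)%N.
  have : (4 < (M + b) ^ 2)%N by nia.
  have : (q <= q ^ 2)%N by nia.
  by nia.
have qR : q%:R != 0 :> R by rewrite pnatr_eq0 -lt0n.
have MR : M%:R != 0 :> R by rewrite pnatr_eq0; lia.
have -> : (radicand q w b i M)%:R = (w * q * M)%:R ^+ 2 *
   ((1 + b%:R * M%:R^-1) ^+ 2 + 4 * q%:R^-1 * (-1) ^+ i * M%:R^-1 ^+ 2) :> R.
  rewrite /radicand -signr_odd natrM.
  case: odd; rewrite ?(natrB _ qM) !(natrX, natrD, natrM) ?expr0 ?expr1;
    by field; rewrite qR MR.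
by rewrite sqrtrM ?sqr_ge0 // sqrtr_sqr ger0_norm.
Qed.

(** The bounds [0 < e < 1] ensure that the sum is not an integer, whether or not [m] is the integer
    nearest to it. *)
Lemma near_integer (R : realType) (K : nat) :
  exists C : R, exists L M0 : nat, [/\ 0 < C, (0 < L)%N, (0 < M0)%N &
  forall M, (M0 <= M)%N -> exists a : 'I_K.+1 -> nat, (forall i, (1 <= a i <= (L * M) ^ 2)%N) /\
  exists m : int,
    let e := `|\sum_i Num.sqrt (a i)%:R - m%:~R| in
    0 < e < 1 /\ e <= C * M%:R^-1 ^+ K.+1].
Proof.
have [q [w [H [d [q0 w0 HP d0 HW]]]]] := positive_weights R K.
have sqrt_error (i : 'I_K.+1) : exists Ci : R, 1 <= Ci /\
    forall x, 0 < x -> Ci * x <= 1 ->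
    `|Num.sqrt ((1 + (K - i)%:R * x) ^+ 2 + 4 * q%:R^-1 * (-1) ^+ i * x ^+ 2)
      - (1 + (K - i)%:R * x + 2 * q%:R^-1 * x ^+ 2 * (H i).[x])|
      <= Ci * x ^+ K.+3.
  by have [E /sqrt_approx[Ci Ci1 CiP]] := HP i; exists Ci.
have [C CP] := fin_all_exists sqrt_error.
pose G := \sum_i (w i)%:R *: H i.
(* The weights kill the coefficients of [G] below [K] and leave [d] at [K], the source of the main
   term [2 d x^(K+1)]. *)
have GE : G = d%:P * 'X^K + drop_poly K.+1 G * 'X^(K.+1).
  rewrite -[LHS](poly_take_drop K.+1); congr (_ + _); apply/polyP=> j.
  rewrite coef_take_poly coefCM coefXn; case: ltnP => [ltjK|ltKj].
    rewrite coef_sum; under eq_bigr do rewrite coefZ.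
    by rewrite (HW (Ordinal ltjK)) mulr_natr -val_eqE.
  by rewrite gtn_eqF ?mulr0.
have [C2 C2_ge0 C2P] := horner_bounded (drop_poly K.+1 G).
pose C3 := 2 * C2 + q%:R * \sum_i (w i)%:R * C i.
have wC_ge0 i : 0 <= (w i)%:R * C i.
  by rewrite mulr_ge0 // (le_trans ler01) ?(CP i).1.
have C3_ge0 : 0 <= C3 by rewrite addr_ge0 ?mulr_ge0 ?sumr_ge0.
have dn0 : 0 < `|d| by rewrite normr_gt0.
have C_ge0 i : 0 <= C i by rewrite (le_trans ler01) ?(CP i).1.
(* With [C4 * x < 1], the three summands give [C i * x <= 1] for the root estimates, a rest at most
   half the main term, and [e < 1]. *)
pose C4 := \sum_i C i + C3 / `|d| + 6 * `|d|.
have C4_ge0 : 0 <= C4 by rewrite !addr_ge0 ?mulr_ge0 ?sumr_ge0 ?divr_ge0 ?normr_ge0.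
exists (3 * `|d|), (q * (K + 3) * \sum_i w i)%N, (Num.trunc C4 + 3)%N.
split; [by rewrite mulr_gt0| |by rewrite addn3|move=> M leM].
  by rewrite !muln_gt0 q0 addn3 (bigD1 ord0) //= addn_gt0 w0.
have M2 : (2 < M)%N by lia.
have C4M : C4 < M%:R.
  have /andP[_ /lt_le_trans->//] := truncn_itv C4_ge0.
  by rewrite ler_nat; lia.
pose x : R := M%:R^-1.
have M_gt0 : 0 < M%:R :> R by rewrite ltr0n (leq_trans _ M2).
have x_gt0 : 0 < x by rewrite invr_gt0.
have Mx : M%:R * x = 1 by rewrite mulfV ?gt_eqF.
have C4x : C4 * x < 1 by rewrite -Mx ltr_pM2r.
have x_le1 : x <= 1 by rewrite invf_le1 // ler1n (leq_trans _ M2).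
have x01 : 0 <= x <= 1 by rewrite ltW.
pose a (i : 'I_K.+1) := radicand q (w i) (K - i) i M.
exists a; split=> [i|].
  have /andP[-> /leq_trans->//] := radicand_bounds (K - i) i q0 (w0 i) M2.
  rewrite leq_exp2r // leq_mul2r; apply/orP; right.
  have : (w i <= \sum_i w i)%N by rewrite (bigD1 i) //= leq_addr.
  have : (K - i + 3 <= K + 3)%N by rewrite leq_add2r leq_subr.
  by move=> h1 h2; rewrite -mulnA mulnC leq_mul // leq_mul.
(* This integer collects the parts [w q (M + b)] of the roots. *)
exists (\sum_i w i * q * (M + (K - i)))%N%:Z.
pose rho (i : 'I_K.+1) := Num.sqrt ((1 + (K - i)%:R * x) ^+ 2
    + 4 * q%:R^-1 * (-1) ^+ i * x ^+ 2)
    - (1 + (K - i)%:R * x + 2 * q%:R^-1 * x ^+ 2 * (H i).[x]).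
(* The tail of [G] and the truncation errors are both [O(x^(K+2))]: the factor [M] costs [rho i] one
   power of [x]. *)
pose rest := 2 * x ^+ K.+2 * (drop_poly K.+1 G).[x]
   + q%:R * M%:R * \sum_i (w i)%:R * rho i.
have sumE : \sum_i Num.sqrt (a i)%:R - (\sum_i w i * q * (M + (K - i)))%N%:~R
    = 2 * d * x ^+ K.+1 + rest :> R.
  have qR : q%:R != 0 :> R by rewrite pnatr_eq0 -lt0n.
  have termE i : Num.sqrt (a i)%:R - (w i * q * (M + (K - i)))%:R =
      2 * x * ((w i)%:R * (H i).[x]) + q%:R * M%:R * ((w i)%:R * rho i).
    rewrite /a sqrt_radicand // -/x /rho; set r := Num.sqrt _; set h := _.[x].
    by rewrite !(natrM, natrD) /x; field; rewrite qR gt_eqF.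
  rewrite -pmulrn natr_sum -sumrB; under eq_bigr do rewrite termE.
  rewrite big_split /= -!mulr_sumr.
  have -> : \sum_i (w i)%:R * (H i).[x] = G.[x].
    by rewrite horner_sum; apply: eq_bigr => i _; rewrite hornerZ.
  rewrite {1}GE !(hornerD, hornerM, hornerC, hornerXn) /rest.
  by rewrite !exprS; ring.
have rest_le : `|rest| <= `|d| * x ^+ K.+1.
  have rho_le i : `|rho i| <= C i * x ^+ K.+3.
    apply: (CP i).2 => //; rewrite (le_trans _ (ltW C4x)) // ler_pM2r //.
    by rewrite /C4 -addrA (bigD1 i) //= -addrA lerDl !addr_ge0 ?sumr_ge0 ?divr_ge0 ?mulr_ge0.
  have sum_le : `|\sum_i (w i)%:R * rho i|
                <= (\sum_i (w i)%:R * C i) * x ^+ K.+3.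
    rewrite mulr_suml (le_trans (ler_norm_sum _ _ _)) // ler_sum // => i _.
    by rewrite normrM normr_nat -mulrA ler_wpM2l.
  have X2 : 0 <= x ^+ K.+2 by apply: exprn_ge0; apply: ltW.
  have h : `|rest| <= C3 * x ^+ K.+2.
    rewrite (le_trans (ler_normD _ _)) // /C3 [leRHS]mulrDl lerD //.
      rewrite normrM ger0_norm; last exact: mulr_ge0.
      rewrite [leRHS]mulrAC; apply: ler_wpM2l; first exact: mulr_ge0.
      exact: C2P.
    rewrite normrM ger0_norm ?mulr_ge0 //.
    have -> : x ^+ K.+2 = M%:R * x ^+ K.+3 by rewrite [in RHS]exprS mulrA Mx mul1r.
    by rewrite -!mulrA ler_wpM2l // [leRHS]mulrCA ler_wpM2l.
  apply: le_trans h _; rewrite exprS mulrA ler_wpM2r ?exprn_ge0 ?(ltW x_gt0) //.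
  have : C3 / `|d| * x <= C4 * x.
    by rewrite ler_pM2r // /C4 -addrA addrCA lerDl addr_ge0 ?sumr_ge0 ?mulr_ge0.
  by move=> /le_trans/(_ (ltW C4x)); rewrite mulrAC ler_pdivrMr // mul1r.
cbv zeta; rewrite {}sumE.
have X_gt0 : 0 < x ^+ K.+1 by rewrite exprn_gt0.
have X_le : x ^+ K.+1 <= x.
  rewrite exprS; apply: ler_piMr; first exact: ltW.
  by apply: exprn_ile1 => //; apply: ltW.
have main : `|2 * d * x ^+ K.+1| = 2 * (`|d| * x ^+ K.+1).
  by rewrite -mulrA normrM normr_nat (normrM d) (gtr0_norm X_gt0).
have up := ler_normD (2 * d * x ^+ K.+1) rest.
have lo := lerB_normD (2 * d * x ^+ K.+1) rest.
have dX : 0 < `|d| * x ^+ K.+1 by rewrite mulr_gt0.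
have dx : 6 * `|d| * x <= C4 * x.
  by rewrite ler_pM2r // lerDr addr_ge0 ?sumr_ge0 ?divr_ge0 ?normr_ge0.
have dXx : `|d| * x ^+ K.+1 <= `|d| * x by rewrite ler_pM2l.
rewrite main in up lo.
by rewrite -/x; split; [apply/andP; split|]; lra.
Qed.

(** * From the parameter [M] to arbitrary [n] *)

Lemma dist_int_gt0 (R : realType) (x : R) (m : int) :
  0 < `|x - m%:~R| < 1 -> 0 < dist_int x.
Proof.
move=> /andP[e0 e1]; have [p ->] := dist_int_attained x.
(* Otherwise [x] is the integer [p], and [p - m] is a nonzero integer of absolute value below 1. *)
rewrite normr_gt0 subr_eq0; apply/eqP => xp; move: e0 e1.
rewrite xp -rmorphB /= -intr_norm ltr0z ltrz1; lia.
Qed.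

Lemma sum_sqrt_near_int (R : realType) (K : nat) :
  exists2 C : R, 0 < C & forall n : nat, (1 < n)%N ->
    exists a : 'I_K.+1 -> nat, (forall i, (1 <= a i <= n)%N) /\
      0 < dist_int (\sum_i Num.sqrt ((a i)%:R : R))
        <= C * (Num.sqrt n%:R)^-1 ^+ K.+1.
Proof.
have [C [L [M0 [C0 L0 M00 near]]]] := near_integer R K.
have C1_ge0 : 0 <= C * (2 * L)%:R ^+ K.+1 .
  by apply: mulr_ge0; [exact: ltW | exact: exprn_ge0].
have C2_gt0 : 0 < (L * M0)%:R ^+ K.+1 :> R by apply: exprn_gt0; rewrite ltr0n muln_gt0 L0.
(* The first summand serves large [n], through [sqrt n <= 2 L M]; the second makes the bound at
   least 1 for the other [n]. *)
exists (C * (2 * L)%:R ^+ K.+1 + (L * M0)%:R ^+ K.+1).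
  exact: ltr_wpDl.
move=> n n1; set r : R := Num.sqrt n%:R.
have r_gt0 : 0 < r by rewrite sqrtr_gt0 ltr0n ltnW.
have V_ge0 : 0 <= r^-1 ^+ K.+1 by rewrite exprn_ge0 // invr_ge0 ltW.
(* The largest [M] with [(L M)^2 <= n]. *)
pose M := (Num.trunc r %/ L)%N.
have /andP[tr_le tr_gt] := truncn_itv (ltW r_gt0).
have r_lt : r < (L * M.+1)%:R.
  apply: lt_le_trans tr_gt _; rewrite ler_nat mulnC.
  exact: ltn_ceil.
have [leM|ltM] := leqP M0 M.
  have [a [a_le [m [/andP[e0 e1] e_le]]]] := near M leM.
  exists a; split=> [i|].
    have /andP[-> /leq_trans->//] := a_le i.
    rewrite -(ler_nat R) natrX -[leRHS]sqr_sqrtr // ler_pXn2r ?nnegrE ?sqrtr_ge0 //.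
    by apply: le_trans _ tr_le; rewrite ler_nat mulnC leq_trunc_div.
  apply/andP; split; first by apply: dist_int_gt0 (m) _; rewrite e0.
  apply: le_trans (dist_int_le _ m) _; apply: le_trans e_le _.
  rewrite mulrDl -[leLHS]addr0; apply: lerD; last by apply: mulr_ge0; rewrite // ltW.
  rewrite -mulrA ler_pM2l // -exprMn ler_pXn2r ?nnegrE ?mulr_ge0 ?invr_ge0 ?sqrtr_ge0 //.
  have M_gt0 : 0 < M%:R :> R by rewrite ltr0n (leq_trans M00).
  rewrite ler_pdivlMr // ler_pdivrMl // (le_trans (ltW r_lt)) // -natrM ler_nat.
  by rewrite mulnC mulnA leq_mul2r muln2 -addnn -addn1 leq_add2l
    (leq_trans M00 leM) orbT.
(* For these bounded [n] any non-integer sum is good enough; [sqrt 2 + K] only requires [n >= 2]. *)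
exists (fun i => if i == ord0 then 2 else 1)%N; split=> [i|].
  by case: eqP => _; rewrite ?n1 ?(ltnW n1).
have e_lt : 0 < `|\sum_(i < K.+1)
    Num.sqrt ((if i == ord0 then 2 else 1)%N%:R : R) - K.+1%:Z%:~R| < 1.
  rewrite big_ord_recl /= (eq_bigr (fun=> 1)) => [|i _]; last by rewrite sqrtr1.
  rewrite sumr_const card_ord -pmulrn -(natr1 K) [K%:R + 1]addrC opprD addrACA subrr addr0.
  have : Num.sqrt 2 ^+ 2 = 2 :> R by rewrite sqr_sqrtr.
  have := sqrtr_ge0 (2 : R); set t := Num.sqrt _ => t_ge0 t2.
  by rewrite gtr0_norm ?subr_gt0; [apply/andP; split|]; nra.
apply/andP; split; first exact: dist_int_gt0 e_lt.
apply: le_trans (dist_int_le _ K.+1%:Z) _.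
have /andP[_ /ltW e_le1] := e_lt; apply: le_trans e_le1 _.
rewrite mulrDl -[leLHS]add0r; apply: lerD; first exact: mulr_ge0.
rewrite -exprMn; apply: exprn_ege1.
rewrite ler_pdivlMr // mul1r (le_trans (ltW r_lt)) // ler_nat.
by rewrite leq_mul2l ltM orbT.
Qed.

(* [n = 1] is excluded: it forces every [a i] to be [1], and then the sum is
   the integer [k], at distance [0]. *)
Theorem mainTheorem1 (R : realType) :
  exists2 c : R, 0 < c &
    forall k : nat, (0 < k)%N ->
      exists2 ck : R, 0 < ck &
        forall n : nat, (1 < n)%N ->
          exists a : 'I_k -> nat,
            (forall i : 'I_k, (1 <= a i <= n)%N) /\
            0 < dist_int (\sum_(i < k) Num.sqrt ((a i)%:R : R))
              <= ck * n%:R `^ (- (c * k%:R `^ (3%:R^-1))).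
Proof.
(* The bound [(sqrt n)^(-k)] is [n^(-k/2)], hence [c = 1/2]; then [k^(1/3) <= k] weakens the
   exponent. *)
exists 2^-1; first by rewrite invr_gt0.
case=> // K _; have [C C0 near] := sum_sqrt_near_int R K.
exists C => // n n1; have [a [a_le /andP[d_gt0 d_le]]] := near n n1.
exists a; split=> //; rewrite d_gt0 /=; apply: le_trans d_le _.
rewrite ler_pM2l // exprVn -powR_mulrn ?sqrtr_ge0 // -powR12_sqrt // -powRrM -powRN.
apply: ler_powR; first by rewrite ler1n ltnW.
rewrite lerN2 ler_pM2l ?invr_gt0 // -[leRHS]powRr1 // ler_powR ?ler1n //.
by rewrite invf_le1 // ler1n.
Qed.
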